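(* Let $s \geq 3$ be odd. Then for all integers $i, j$ with $1 \leq i \leq s+1$ and $1 \leq j \leq s-1$, $$(s+1)(j-1) + i \in P_{\{s,s+2\}} \Longleftrightarrow (s+1)(s-1-j) + i \notin P_{\{s,s+2\}}.$$ Equivalently, the $(i,j)$-entry of the rectangle $R_s$ is an element of $P_{\{s,s+2\}}$ if and only if the $(i,s-j)$-entry is not.
   Context: For a set $S$ of positive integers, $P_S$ denotes the set of positive integers that cannot be written as a non-negative integer linear combination of elements of $S$. $R_s$ denotes the $(s+1)\times(s-1)$ rectangular array whose $(i,j)$-entry, for $1\le i\le s+1$ and $1\le j\le s-1$, is $(s+1)(j-1)+i$. *)

(* Defs.v *)
From mathcomp Require Import all_boot all_algebra.
From mathcomp Require Import classical_sets.

Set Implicit Arguments.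
Unset Strict Implicit.
Unset Printing Implicit Defensive.

Local Open Scope nat_scope.
Local Open Scope classical_set_scope.

(* A linear combination is given by a finite list of (coefficient, element)
   pairs, so that S may be infinite; the empty list gives 0. *)
Definition is_nat_comb (S : set nat) (n : nat) : Prop :=
  exists l : seq (nat * nat),
    (forall p, p \in l -> S p.2) /\ n = \sum_(p <- l) p.1 * p.2.

Definition P (S : set nat) : set nat :=
  [set n | 0 < n /\ ~ is_nat_comb S n].

(* Ordinals start at 0, so the 1-based (i, j)-entry (s + 1)(j - 1) + i is stored
   at position (i - 1, j - 1). *)
Definition rect (s : nat) : 'M[nat]_(s + 1, s - 1) :=
  (\matrix_(i < s + 1, j < s - 1) ((s + 1) * j + (i + 1))%N)%R.

(* Main.v *)
(* Since x s + y (s + 2) = (x + y)(s + 1) + (y - x), an entry (s + 1) c + i with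
   c <= s - 2 and 1 <= i <= s + 1 can only be represented with x + y = c and
   y - x = i, or with x + y = c + 1 and y - x = i - (s + 1).  For s odd the first
   needs i = c (mod 2) and i <= c, the second i <> c (mod 2) and s <= i + c.
   Replacing c by s - 2 - c flips the parity of c and negates the criterion. *)
Require Import Defs.
From mathcomp Require Import all_boot all_algebra.
From mathcomp Require Import classical_sets.
From mathcomp Require Import zify.

Local Open Scope nat_scope.
Local Open Scope classical_set_scope.

Lemma is_nat_comb_set2 (a b n : nat) :
  is_nat_comb [set a; b] n <-> exists x y, n = x * a + y * b.
Proof.
split=> [[l [lS ->]]|[x [y ->]]]; last first.
  exists [:: (x, a); (y, b)]; split; last by rewrite !big_cons big_nil addn0.
  by move=> p; rewrite !inE => /orP[] /eqP ->; [left | right].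
elim: l lS => [|[k e] l IHl] lS; first by exists 0, 0; rewrite big_nil.
have [|x [y lE]] := IHl; first by move=> p pl; apply: lS; rewrite inE pl orbT.
rewrite big_cons lE /=.
have [/= -> | /= ->] := lS (k, e) (mem_head _ _).
- by exists (k + x), y; rewrite mulnDl addnA.
- by exists x, (k + y); rewrite mulnDl addnCA.
Qed.

Lemma nat_comb_entryP (s c i : nat) : odd s -> c + 2 <= s -> 1 <= i <= s + 1 ->
  is_nat_comb [set s; s + 2] ((s + 1) * c + i) <->
  (if odd i == odd c then i <= c else s <= i + c).
Proof.
move=> s_odd c_le i_bnd; rewrite is_nat_comb_set2; split=> [[x [y E]]|].
  have k_ge : c <= x + y.
    rewrite leqNgt; apply/negP => k_lt.
    (* Too few summands: (c - 1)(s + 2) < (s + 1)c since c <= s - 2. *)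
    have : (x + y + 1) * (s + 2) <= c * (s + 2) by rewrite leq_mul2r; lia.
    nia.
  have k_le : x + y <= c + 1.
    rewrite leqNgt; apply/negP => k_gt.
    (* Too many: (c + 2)s >= (s + 1)c + s + 2, beyond the entry. *)
    have : (c + 2) * s <= (x + y) * s by rewrite leq_mul2r; lia.
    nia.
  have [k_eq|k_eq] : x + y = c \/ x + y = c + 1 by lia.
  - have d_eq : i + x = y by rewrite -k_eq in E; nia.
    by case: ifP; lia.
  - have d_eq : i + x = y + (s + 1).
      have c_eq : c = x + y - 1 by lia.
      by nia.
    by case: ifP; lia.
case: ifP => par le_i.
(* Both witness pairs solve for x and y from x + y and y - x; parity makes the halves exact. *)
- exists ((c - i)./2), ((c + i)./2).
  have yE : (c + i)./2 = (c - i)./2 + i by lia.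
  have cE : c = (c - i)./2 + (c - i)./2 + i by lia.
  by rewrite yE {1}cE; nia.
- exists ((c + (s + 2) - i)./2), ((c + i - s)./2).
  have xE : (c + (s + 2) - i)./2 + i = (c + i - s)./2 + (s + 1) by lia.
  have cE : c + 1 = (c + (s + 2) - i)./2 + (c + i - s)./2 by lia.
  by nia.
Qed.

Lemma P_entry_sym (s c c' i : nat) :
  odd s -> c + c' + 2 = s -> 1 <= i <= s + 1 ->
  P [set s; s + 2] ((s + 1) * c + i) <->
  ~ P [set s; s + 2] ((s + 1) * c' + i).
Proof.
move=> s_odd c_c' i_bnd; rewrite /P /= !nat_comb_entryP //; try lia.
have pos k : 0 < (s + 1) * k + i by lia.
(* For i = c (mod 2) the criteria at [c] and [c'] read i <= c and i >= c + 2; parity excludes the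
   gap i = c + 1. Otherwise swap [c] and [c']. *)
rewrite !pos; case: ifP; case: ifP; lia.
Qed.

(* In 1-based terms [rev_ord] sends column j of [rect s] to column s - j. *)
Theorem theorem2p2 (s : nat) (s_ge3 : 3 <= s) (s_odd : odd s) :
  (forall i j : nat, 1 <= i <= s + 1 -> 1 <= j <= s - 1 ->
     P [set s; s + 2] ((s + 1) * (j - 1) + i) <->
     ~ P [set s; s + 2] ((s + 1) * (s - 1 - j) + i))
  /\
  (forall (i : 'I_(s + 1)) (j : 'I_(s - 1)),
     P [set s; s + 2] (rect s i j) <->
     ~ P [set s; s + 2] (rect s i (rev_ord j))).
Proof.
split=> [i j i_bnd j_bnd|i j]; first by apply: P_entry_sym => //; lia.
have := ltn_ord i; have := ltn_ord j.
by rewrite !mxE => j_lt i_lt; apply: P_entry_sym => //=; lia.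
Qed.
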